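(* Let $n\ge 2$, $k\ge0$, $p\ge 0$ and $q$ be integers with $\Phi(q)=2n+2k$, where $q$ has one of the following forms: (i) $q=q_1q_2$ with $q_1,q_2$ distinct odd primes; (ii) $q=q_1$ prime; (iii) $q=q_1^2$ with $q_1$ prime; (iv) $q=q_1^3$ with $q_1$ prime. Let $G$ and $G'$ be the cyclic subgroups of $O(2n)$ generated by the matrices attached (as in the context) to two choices $R$ and $R'$ of the defining set, with the same $n,p,q$. Then the generating functions for $p$-forms satisfy $F^p_G(z)=F^p_{G'}(z)$ if and only if $\tilde K^p_G(z)=\tilde K^p_{G'}(z)$, where $\tilde K^p_G(z)$ is the Laurent polynomial defined as follows. For a finite set $T$ of integers write $$P_T(z)=\sum_{c=-p}^{2k}(-1)^c z^c\sum_{a=\max(0,c)}^{\min(2k,c+p)}\ \sum_{t\in T}\chi^{p-a+c}(g^t)\,\chi^a(\bar g^t)\;+\;\sum_{c=2}^{2k+p+2}(-1)^{c+1}z^c\sum_{a=\max(0,c-2-p)}^{\min(2k,c-2)}\ \sum_{t\in T}\chi^{p+2+a-c}(g^t)\,\chi^a(\bar g^t).$$ (i) If $q=q_1q_2$ with $q_1,q_2$ distinct odd primes, $$\tilde K^p_G(z)=\Psi_{q_1}(z)^{q_2-1}\Psi_{q_2}(z)^{q_1-1}P_{T_0}(z)+\Psi_q(z)\Psi_{q_1}(z)^{q_2-1}P_{T_1}(z)+\Psi_q(z)\Psi_{q_2}(z)^{q_1-1}P_{T_2}(z),$$ where $T_0=\{1\le t\le q-1:\gcd(t,q)=1\}$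 and $T_i=\{1\le t\le q-1:\gcd(t,q_i)\ne1\}$ for $i=1,2$. (ii) If $q=q_1$ is prime, $\tilde K^p_G(z)=P_T(z)$ with $T=\{1,2,\dots,q\}$. (iii) If $q=q_1^2$ with $q_1$ prime, $$\tilde K^p_G(z)=\Psi_{q_1}(z)^{q_1}P_{T_0}(z)+\Psi_{q_1}(z^{q_1})P_{T_1}(z),$$ where $T_0=\{1\le t\le q_1^2-1:\gcd(t,q)=1\}$ and $T_1=\{t'q_1: 1\le t'\le q_1-1\}$. (iv) If $q=q_1^3$ with $q_1$ prime, $$\tilde K^p_G(z)=\Psi_{q_1}(z^{q_1})^{q_1}\Psi_{q_1}(z)^{q_1^2}P_{T_0}(z)+\Psi_{q_1}(z^{q_1^2})\Psi_{q_1}(z)^{q_1^2}P_{T_1}(z)+\Psi_{q_1}(z^{q_1^2})\Psi_{q_1}(z^{q_1})^{q_1}P_{T_2}(z),$$ where $T_0=\{1\le t\le q_1^3-1:\gcd(t,q_1)=1\}$, $T_1=\{t'q_1:1\le t'\le q_1^2-1,\ \gcd(t',q_1)=1\}$ and $T_2=\{t'q_1^2:1\le t'\le q_1-1\}$. ($\tilde K^p_{G'}$ is defined in the same way from $R'$.)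
   Context: $\Phi$ is Euler's totient function. $\Psi_N(z)=\prod_\eta(z-\eta)$, with $\eta$ running over all primitive $N$-th roots of unity, is the $N$-th cyclotomic polynomial. Let $RP_q=\{\pm t:t\in\mathbb N,\ t<q/2,\ \gcd(t,q)=1\}$, a complete set of representatives, contained in $(-q/2,q/2)$, of the integers modulo $q$ relatively prime to $q$. A choice of the defining set is a set $R=\{r_1,\dots,r_n\}\subseteq RP_q$ of $n$ distinct elements with $R\cap(-R)=\emptyset$ modulo $q$. Given $R$, choose $S=\{s_1,\dots,s_k\}\subseteq RP_q\setminus(\pm R)$ of $k$ distinct elements with $S\cap(-S)=\emptyset$ modulo $q$; thus $RP_q$ is the disjoint union of $\pm R$ and $\pm S$ (and $S$ is determined by $R$ up to signs of its elements, which do not affect the characters below). For real $\nu$, $\mathrm{Rot}(\nu)=\begin{pmatrix}\cos(2\pi\nu)&\sin(2\pi\nu)\\-\sin(2\pi\nu)&\cos(2\pi\nu)\end{pmatrix}$. The matrix $g\in O(2n)$ is block diagonal with blocks $\mathrm{Rot}(r_1/q),\dots,\mathrm{Rot}(r_n/q)$, and $\bar g\in O(2k)$ is block diagonal with blocks $\mathrm{Rot}(s_1/q),\dots,\mathrm{Rot}(s_k/q)$. $G$ is the cyclic group of order $q$ generated by $g$; it acts freely on the unit sphere $S^{2n-1}$, with quotient a lens space. $\chi^a(g^t)$ denotes the trace of $g^t$ acting on $\Lambda^a(\mathbb R^{2n})$ by $A\cdot(v_1\wedge\cdots\wedge v_a)=Av_1\wedge\cdots\wedge Av_a$, and $\chi^a(\bar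 g^t)$ the trace of $\bar g^t$ acting likewise on $\Lambda^a(\mathbb R^{2k})$ (with $\Lambda^0=\mathbb R$ trivial, and $\chi^a=0$ when $a$ exceeds the dimension). $\det(z-g^t)$ means $\det(zI_{2n}-g^t)$. The generating function of $G$ for $p$-forms is the rational function $$F^p_G(z)=|G|^{-1}\sum_{b=0}^p(-1)^b\bigl(z^{-b}-z^{b+2}\bigr)\sum_{t=1}^q\frac{\chi^{p-b}(g^t)}{\det(z-g^t)}+(-1)^{p+1}z^{-p}.$$ It encodes the closed/coclosed part of the $p$-form spectrum of the lens space $S^{2n-1}/G$: two lens spaces have the same $p$-form spectrum if and only if both their $F^p$ and their $F^{p-1}$ agree. ''Equality of closed or coclosed $p$-forms'' for two groups means equality of their functions $F^p$. *)

(* Defs.v *)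
From HB Require Import structures.
From mathcomp Require Import all_boot all_order all_fingroup all_algebra all_field.
From mathcomp Require Import reals trigo.

Set Implicit Arguments.
Unset Strict Implicit.
Unset Printing Implicit Defensive.

Import Order.TTheory GRing.Theory Num.Theory.
Local Open Scope ring_scope.

(* Exterior powers of the column space R^m.  The standard basis of
   Lambda^a (R^m) is (e_(f 0) /\ ... /\ e_(f (a-1))), for f strictly increasing,
   and an element of Lambda^a (R^m) is the column of its coordinates. *)

Section ExteriorPower.
Variable R : comNzRingType.

Definition incr a m :=
  {f : {ffun 'I_a -> 'I_m} | [forall i : 'I_a, forall j : 'I_a, (i < j)%N ==> (f i < f j)%N]}.

Definition ext_dim a m := #|{: incr a m}|.

Definition ext_idx a m (I : 'I_(ext_dim a m)) : {ffun 'I_a -> 'I_m} :=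
  val (enum_val I).

(* v_1 /\ ... /\ v_a, where the v_j are the columns of V. *)
Definition wedge a m (V : 'M[R]_(m, a)) : 'cV[R]_(ext_dim a m) :=
  \col_I \det (rowsub (ext_idx I) V).

(* Column J is the image A e_(j_1) /\ ... /\ A e_(j_a) of the J-th basis vector. *)
Definition ext_power a m (A : 'M[R]_m) : 'M[R]_(ext_dim a m) :=
  \matrix_(I, J) wedge (colsub (ext_idx J) A) I 0.

Definition ext_char a m (A : 'M[R]_m) : R := \tr (ext_power a A).

Lemma incr_mono a m (I : 'I_(ext_dim a m)) (i j : 'I_a) :
  (ext_idx I i < ext_idx I j)%N = (i < j)%N.
Proof.
have H (x y : 'I_a) : (x < y)%N -> (ext_idx I x < ext_idx I y)%N.
  by have /forallP/(_ x)/forallP/(_ y)/implyP := valP (enum_val I).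
case: (ltngtP i j) => [/H|/H|/val_inj ->]; rewrite ?ltnn //.
by move=> h; apply/negbTE; rewrite -leqNgt ltnW.
Qed.

Lemma ext_idx_inj a m (I : 'I_(ext_dim a m)) : injective (ext_idx I).
Proof.
move=> i j e; apply: val_inj; apply/eqP.
by rewrite eqn_leq leqNgt (leqNgt j) -!(incr_mono I) e ltnn.
Qed.

Lemma ext_idx_codom a m (I J : 'I_(ext_dim a m)) :
  codom (ext_idx I) =i codom (ext_idx J) -> I = J.
Proof.
move=> e; apply: enum_val_inj; apply: val_inj; apply/ffunP => i.
suff E : codom (ext_idx I) = codom (ext_idx J).
  have := congr1 (fun s => nth (ext_idx I i) s (enum_rank i)) E.
  by rewrite /= !nth_codom enum_rankK.
have S K : sorted ltn [seq val x | x <- codom (@ext_idx a m K)].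
  rewrite codomE -map_comp.
  apply: (homo_sorted (e := fun x y : 'I_a => (x < y)%N)).
    by move=> x y /=; rewrite incr_mono.
  by have := iota_ltn_sorted 0 a; rewrite -val_enum_ord sorted_map.
apply: (inj_map val_inj); apply: (irr_sorted_eq ltn_trans ltnn) => //.
by move=> x; apply/mapP/mapP => -[y]; rewrite ?e => h ->; exists y; rewrite ?e // -e.
Qed.

Lemma ext_idx_surj a m (f : {ffun 'I_a -> 'I_m}) : injective f ->
  exists I : 'I_(ext_dim a m), exists s : 'S_a, f = [ffun i => ext_idx I (s i)].
Proof.
move=> fi; pose A := [set f i | i in 'I_a].
have cA : #|A| = a by rewrite card_imset // card_ord.
have fA i : f i \in A by apply/imsetP; exists i.
pose g : {ffun 'I_a -> 'I_m} := [ffun i => enum_val (cast_ord (esym cA) i)].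
have gP : [forall i : 'I_a, forall j : 'I_a, (i < j)%N ==> (g i < g j)%N].
  apply/forallP => i; apply/forallP => j; apply/implyP => ij.
  have so : sorted (fun x y : 'I_m => (x < y)%N) (enum A).
    rewrite /(enum _); apply: sorted_filter; first by move=> x y w; apply: ltn_trans.
    by have := iota_ltn_sorted 0 m; rewrite -enumT -val_enum_ord sorted_map.
  rewrite !ffunE /enum_val.
  set x0 := enum_default _; rewrite (set_nth_default x0 (enum_default _)) -?cardE ?cA //=.
  rewrite (sorted_ltn_nth (leT := fun x y : 'I_m => (x < y)%N)) //; last first.
  - by rewrite inE -cardE cA.
  - by rewrite inE -cardE cA.
  - by move=> x y w; apply: ltn_trans.
  - by rewrite cA.
pose sf i := cast_ord cA (enum_rank_in (fA i) (f i)).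
have gs i : g (sf i) = f i.
  by rewrite ffunE /sf cast_ord_comp cast_ord_id enum_rankK_in.
have si : injective sf by move=> i j e; apply: fi; rewrite -!gs e.
exists (enum_rank (exist _ g gP)), (perm si); apply/ffunP => i.
by rewrite ffunE /ext_idx enum_rankK /= permE gs.
Qed.

(* A (v_1 /\ ... /\ v_a) = A v_1 /\ ... /\ A v_a, by the Cauchy-Binet formula. *)
Lemma ext_power_wedge a m (A : 'M[R]_m) (V : 'M[R]_(m, a)) :
  ext_power a A *m wedge V = wedge (A *m V).
Proof.
apply/colP => I; rewrite !mxE.
pose F (f : {ffun 'I_a -> 'I_m}) :=
  (\prod_i A (ext_idx I i) (f i)) * \det (rowsub f V).
have -> : \det (rowsub (ext_idx I) (A *m V)) = \sum_f F f.
  pose G (s : 'S_a) (f : {ffun 'I_a -> 'I_m}) :=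
    (-1) ^+ s * \prod_i (A (ext_idx I i) (f i) * V (f i) (s i)).
  transitivity (\sum_(s : 'S_a) \sum_f G s f).
    apply: eq_bigr => s _; rewrite -big_distrr /=; congr (_ * _).
    under eq_bigr do rewrite !mxE.
    by rewrite bigA_distr_bigA.
  rewrite exchange_big; apply: eq_bigr => f _.
  rewrite /F /determinant big_distrr /=; apply: eq_bigr => s _.
  rewrite /G big_split mulrCA; congr (_ * (_ * _)).
  by apply: eq_bigr => i _; rewrite mxE.
rewrite (bigID (fun f : {ffun 'I_a -> 'I_m} => injectiveb f)) /= [X in _ + X]big1 ?addr0; last first.
  move=> f /injectivePn [i [j ij e]].
  rewrite /F (determinant_alternate ij) ?mulr0 // => x.
  by rewrite !mxE e.
pose h (u : 'I_(ext_dim a m) * 'S_a) : {ffun 'I_a -> 'I_m} :=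
  [ffun i => ext_idx u.1 (u.2 i)].
have hc u : codom (h u) =i codom (ext_idx u.1).
  move=> x; apply/codomP/codomP => -[i ->].
    by exists (u.2 i); rewrite ffunE.
  by exists ((u.2^-1)%g i); rewrite ffunE permKV.
have hi : injective h.
  move=> u v e; have e1 : u.1 = v.1.
    by apply: ext_idx_codom => x; rewrite -!hc e.
  case: u v e1 e => [J s] [_ t] /= <- /ffunP e; congr (_, _).
  apply/permP => i; apply: (@ext_idx_inj _ _ J).
  by have := e i; rewrite !ffunE.
transitivity (\sum_u F (h u)); last first.
  rewrite -(big_imset F (h := h) (A := predT)) /=; last by move=> ? ? _ _; apply: hi.
  apply: eq_bigl => f; apply/imsetP/injectiveP => [[u _ ->] i j|].
    by rewrite !ffunE => /ext_idx_inj /perm_inj.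
  by move=> /ext_idx_surj [J [s ->]]; exists (J, s).
rewrite -(pair_bigA _ (fun J s => F (h (J, s)))) /=; apply: eq_bigr => J _.
rewrite !mxE /determinant big_distrl /=; apply: eq_bigr => s _.
rewrite /F -mulrA mulrCA; congr (_ * _).
  by apply: eq_bigr => i _; rewrite !mxE ffunE.
rewrite -/(determinant _).
have -> : rowsub (h (J, s)) V = row_perm s (rowsub (ext_idx J) V).
  by apply/matrixP => i j; rewrite !mxE ffunE.
by rewrite row_permE det_mulmx det_perm.
Qed.

Lemma wedge_basis a m (J : 'I_(ext_dim a m)) :
  wedge (colsub (ext_idx J) 1%:M : 'M[R]_(m, a)) = delta_mx J 0.
Proof.
apply/colP => I; rewrite !mxE eqxx andbT.
have [->|IJ] := eqVneq I J.
  rewrite -[RHS](det1 R a); congr (\det _); apply/matrixP => i j.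
  by rewrite !mxE (inj_eq (@ext_idx_inj _ _ J)).
have [i iN] : exists i, ext_idx I i \notin codom (ext_idx J).
  apply/existsP; apply: contraNT IJ; rewrite negb_exists => /forallP H.
  apply/eqP/ext_idx_codom => x.
  have sub : {subset codom (ext_idx I) <= codom (ext_idx J)}.
    by move=> _ /codomP [i ->]; have := H i; rewrite negbK.
  have u K : uniq (codom (@ext_idx a m K)).
    by apply/injectiveP; apply: ext_idx_inj.
  by have [] := uniq_min_size (u I) sub; rewrite ?size_codom.
rewrite (expand_det_row _ i) big1 //= => j _; rewrite !mxE.
case: eqP => [e|_]; last by rewrite mul0r.
by case/negP: iN; rewrite e codom_f.
Qed.

End ExteriorPower.

Arguments ext_char {R} a {m} A.

Section LensSpace.
Variable R : realType.

Definition Rot (nu : R) : 'M[R]_2 :=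
  let c := cos (2 * pi * nu) in let s := sin (2 * pi * nu) in
  \matrix_(i < 2, j < 2) nth 0 (nth [::] [:: [:: c; s]; [:: - s; c]] i) j.

Definition rot_mx (q n : nat) (r : 'I_n -> int) : 'M[R]_(\sum_(i < n) 2) :=
  \mxdiag_(i < n) Rot ((r i)%:~R / q%:R).

Definition RP (q : nat) : pred int :=
  [pred x : int | (2 * `|x| < q)%N && coprime `|x| q].

(* An n-element subset of RP q, enumerated by r, meeting its opposite in the
   empty set modulo q. *)
Definition half_set (q n : nat) (r : 'I_n -> int) : Prop :=
  [/\ injective r,
      forall i, r i \in RP q
    & forall i j, (r i != - r j %[mod q%:Z])%Z].

Definition defining_sets (q n k : nat) (r : 'I_n -> int) (s : 'I_k -> int) : Prop :=
  [/\ half_set q r, half_set q s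
    & forall i j, s j != r i /\ s j != - r i].

Definition ratfun := {fraction {poly R}}.

Definition polyF (f : {poly R}) : ratfun := tofrac f.
Definition cstF (x : R) : ratfun := polyF x%:P.
Definition zvar : ratfun := polyF 'X.

(* g generates a cyclic group of order q, so |G| = q; and det (z - g ^ t) is the
   characteristic polynomial of g ^ t. *)
Definition genfun (p q n : nat) (r : 'I_n -> int) : ratfun :=
  let g := rot_mx q r in
  (q%:R)^-1 *
    (\sum_(0 <= b < p.+1) (-1) ^+ b * (zvar ^- b - zvar ^+ (b + 2)) *
       \sum_(1 <= t < q.+1)
          cstF (ext_char (p - b) (g ^+ t)) / polyF (char_poly (g ^+ t)))
  + (-1) ^+ p.+1 * zvar ^- p.

Definition Psi (N : nat) : {poly R} := map_poly intr 'Phi_N.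

Definition char_sum (q n k : nat) (r : 'I_n -> int) (s : 'I_k -> int)
    (T : seq nat) (a b : nat) : ratfun :=
  cstF (\sum_(t <- T)
          ext_char a (rot_mx q r ^+ t) * ext_char b (rot_mx q s ^+ t)).

(* The exponent c of the first sum ranges over the integers from -p to 2k; it is
   written c = d - p with d natural.  Then max (0, c) is the truncated difference
   d - p, c + p is d and p - a + c is d - a.  In the second sum all differences
   are taken where they are nonnegative, except for c - 2 - p, which stands for
   max (0, c - 2 - p).  T is a duplicate-free list. *)
Definition P_sum (p q n k : nat) (r : 'I_n -> int) (s : 'I_k -> int)
    (T : seq nat) : ratfun :=
  \sum_(0 <= d < (2 * k + p).+1)
     (let c := d%:Z - p%:Z in
      (-1) ^ c * zvar ^ c *
      \sum_(d - p <= a < (minn (2 * k) d).+1) char_sum q r s T (d - a) a)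
  + \sum_(2 <= c < (2 * k + p + 2).+1)
      (-1) ^+ c.+1 * zvar ^+ c *
      \sum_(c - 2 - p <= a < (minn (2 * k) (c - 2)).+1)
         char_sum q r s T (p + 2 + a - c) a.

Definition Ktilde_two_primes (p q1 q2 n k : nat) (r : 'I_n -> int) (s : 'I_k -> int)
    : ratfun :=
  let q := (q1 * q2)%N in
  let T0 := [seq t <- index_iota 1 q | gcdn t q == 1%N] in
  let T1 := [seq t <- index_iota 1 q | gcdn t q1 != 1%N] in
  let T2 := [seq t <- index_iota 1 q | gcdn t q2 != 1%N] in
  polyF (Psi q1 ^+ (q2 - 1) * Psi q2 ^+ (q1 - 1)) * P_sum p q r s T0
  + polyF (Psi q * Psi q1 ^+ (q2 - 1)) * P_sum p q r s T1
  + polyF (Psi q * Psi q2 ^+ (q1 - 1)) * P_sum p q r s T2.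

Definition Ktilde_prime (p q n k : nat) (r : 'I_n -> int) (s : 'I_k -> int)
    : ratfun :=
  P_sum p q r s (index_iota 1 q.+1).

Definition Ktilde_prime_square (p q1 n k : nat) (r : 'I_n -> int) (s : 'I_k -> int)
    : ratfun :=
  let q := (q1 ^ 2)%N in
  let T0 := [seq t <- index_iota 1 q | gcdn t q == 1%N] in
  let T1 := [seq (t' * q1)%N | t' <- index_iota 1 q1] in
  polyF (Psi q1 ^+ q1) * P_sum p q r s T0
  + polyF (Psi q1 \Po 'X^q1) * P_sum p q r s T1.

Definition Ktilde_prime_cube (p q1 n k : nat) (r : 'I_n -> int) (s : 'I_k -> int)
    : ratfun :=
  let q := (q1 ^ 3)%N in
  let T0 := [seq t <- index_iota 1 q | gcdn t q1 == 1%N] in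
  let T1 := [seq (t' * q1)%N | t' <- index_iota 1 (q1 ^ 2) & gcdn t' q1 == 1%N] in
  let T2 := [seq (t' * q1 ^ 2)%N | t' <- index_iota 1 q1] in
  polyF ((Psi q1 \Po 'X^q1) ^+ q1 * Psi q1 ^+ (q1 ^ 2)) * P_sum p q r s T0
  + polyF ((Psi q1 \Po 'X^(q1 ^ 2)) * Psi q1 ^+ (q1 ^ 2)) * P_sum p q r s T1
  + polyF ((Psi q1 \Po 'X^(q1 ^ 2)) * (Psi q1 \Po 'X^q1) ^+ q1)
      * P_sum p q r s T2.

End LensSpace.

(* Main.v *)
(* For each t, det(z - g^t) det(z - gbar^t) is the product of the z - w^(xt) over
   the units x modulo q, where w = exp(2 i pi / q).  Reducing the units modulo
   N = q / gcd(t, q) has fibers of equal size, so this product is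
   Psi_N^(Phi(q) / Phi(N)), which depends on gcd(t, q) only.  On the other hand
   det(z - gbar^t) = det(1 - z gbar^t) is the alternating sum of the
   z^a chi^a(gbar^t).  Hence F^p is, up to a term independent of R, the sum over
   the values d < q of gcd(t, q) of P_T / Psi_(q/d)^(Phi(q) / Phi(q/d)), with T the
   set of t having gcd(t, q) = d, plus the term t = q, where g^t = 1.  Clearing
   denominators in the sum over d gives the Laurent polynomial of the theorem. *)
Require Import Defs.
From HB Require Import structures.
From mathcomp Require Import all_boot all_order all_fingroup all_algebra all_field.
From mathcomp Require Import reals trigo.
From mathcomp Require Import cyclic complex.
From mathcomp Require Import ring lra zify.

Set Implicit Arguments.
Unset Strict Implicit.
Unset Printing Implicit Defensive.

Import Order.TTheory GRing.Theory Num.Theory.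
Local Open Scope ring_scope.

(** * Traces of exterior powers *)

Section ExteriorCharacters.
Variable R : comNzRingType.

(* Both sides are the determinant of the block matrix [[1, -V], [U, 1]]. *)
Lemma det_1addmxC a m (U : 'M[R]_(m, a)) (V : 'M[R]_(a, m)) :
  \det (1%:M + U *m V) = \det (1%:M + V *m U).
Proof.
pose M := block_mx 1%:M (- V) U 1%:M.
pose W := block_mx 1%:M V 0 1%:M : 'M[R]_(a + m).
have dW : \det W = 1 by rewrite det_ublock !det1 mulr1.
transitivity (\det M).
  transitivity (\det (M *m W)); last by rewrite det_mulmx dW mulr1.
  rewrite mulmx_block !mul1mx !mulmx1 !mulmx0 addrN addr0 det_lblock det1 mul1r.
  by rewrite addrC.
transitivity (\det (W *m M)); first by rewrite det_mulmx dW mul1r.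
rewrite mulmx_block !mul1mx !mulmx1 !mul0mx addNr !add0r.
by rewrite det_lblock det1 mulr1.
Qed.

(** Each factor in the Leibniz expansion is an entry of the identity plus an entry of [A];
    distributing the product amounts to choosing the set [S] of rows taken from [A]. *)
Lemma det_1addmx_rows m (A : 'M[R]_m) :
  \det (1%:M + A) =
  \sum_(S : {set 'I_m})
    \det (\matrix_(i, j) if i \in S then A i j else (i == j)%:R).
Proof.
rewrite /determinant exchange_big /=; apply: eq_bigr => s _.
rewrite -big_distrr /=; congr (_ * _).
under eq_bigr do rewrite !mxE addrC.
by rewrite bigA_distr; apply: eq_bigr => S _; apply: eq_bigr => i _; rewrite mxE.
Qed.

(** With [P] the rows of the identity selected by [f], the large matrix is a perturbation of 1
    factoring through dimension [a]. Since P P^T = 1, swapping the two factors by [det_1addmxC]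
    leaves exactly the principal submatrix. *)
Lemma det_principal a m (f : 'I_a -> 'I_m) (A : 'M[R]_m) : injective f ->
  \det (\matrix_(i, j) if i \in [set f l | l : 'I_a] then A i j else (i == j)%:R) =
  \det (mxsub f f A).
Proof.
move=> fi; pose P : 'M[R]_(a, m) := rowsub f 1%:M.
have -> : (\matrix_(i, j) if i \in [set f l | l : 'I_a] then A i j else (i == j)%:R)
          = 1%:M + P^T *m (rowsub f A - P).
  apply/matrixP => i j; rewrite !mxE.
  case: ifP => [/imsetP[l _ ->]|iN].
    rewrite (bigD1 l) //= !mxE eqxx mul1r big1 ?addr0 => [|l' l'l].
      by rewrite addrC subrK.
    by rewrite !mxE (inj_eq fi) (negbTE l'l) mul0r.
  rewrite big1 ?addr0 // => l _; rewrite !mxE.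
  case: eqP => [e|_]; last by rewrite mul0r.
  by case/negP: (negbT iN); rewrite -e imset_f.
rewrite det_1addmxC; congr (\det _); apply/matrixP => l l'; rewrite !mxE.
rewrite (bigD1 (f l')) //= !mxE eqxx mulr1 big1 ?addr0 => [|j jl].
  by rewrite (inj_eq fi) addrC subrK.
by rewrite !mxE [f l' == j]eq_sym (negbTE jl) mulr0.
Qed.

Lemma ext_charE a m (A : 'M[R]_m) :
  ext_char a A = \sum_I \det (mxsub (@ext_idx a m I) (@ext_idx a m I) A).
Proof.
apply: eq_bigr => I _; rewrite !mxE; congr (\det _).
by apply/matrixP => i j; rewrite !mxE.
Qed.

(** The row sets of [det_1addmx_rows] are grouped by cardinality: those of size [a] are the images
    of the increasing maps, and their principal minors are the diagonal entries of the exterior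
    power. *)
Lemma sum_ext_char m (A : 'M[R]_m) :
  \det (1%:M + A) = \sum_(0 <= a < m.+1) ext_char a A.
Proof.
rewrite det_1addmx_rows big_mkord.
rewrite (partition_big (fun S : {set 'I_m} => inord #|S| : 'I_m.+1) xpredT) //=.
apply: eq_bigr => a _; rewrite ext_charE.
pose h (I : 'I_(ext_dim a m)) := [set ext_idx I l | l : 'I_a].
have hi : injective h.
  move=> I J e; apply: ext_idx_codom => x.
  have hE K : (x \in codom (ext_idx K)) = (x \in h K).
    by apply/codomP/imsetP => [[l ->]|[l _ ->]]; exists l.
  by rewrite !hE e.
rewrite -(eq_bigr _ (fun I _ => det_principal A (@ext_idx_inj a m I))).
rewrite -(big_imset (fun S : {set 'I_m} =>
  \det (\matrix_(i, j) if i \in S then A i j else (i == j)%:R)) (h := h) (A := predT)) /=;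
  last by move=> ? ? _ _; apply: hi.
apply: eq_bigl => S; apply/eqP/imsetP => [Sa|[I _ ->]]; last first.
  by apply: val_inj; rewrite /= inordK ?card_imset ?card_ord //; apply: ext_idx_inj.
have cS : #|S| = a by rewrite -Sa inordK // ltnS -[X in (_ <= X)%N](card_ord m) max_card.
(* Any enumeration of [S] is an increasing one up to a permutation, which does not change the
   image. *)
have [|I [s fI]] := @ext_idx_surj a m [ffun i => enum_val (cast_ord (esym cS) i)].
  by move=> i j; rewrite !ffunE => /enum_val_inj/cast_ord_inj.
exists I => //; apply/esym/eqP; rewrite eqEcard /h card_imset ?card_ord ?cS ?leqnn ?andbT;
  last exact: ext_idx_inj.
apply/subsetP => _ /imsetP[i _ ->].
have := congr1 (fun g : {ffun 'I_a -> 'I_m} => g ((s^-1)%g i)) fI.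
by rewrite !ffunE permKV => <-; apply: enum_valP.
Qed.

Lemma ext_charZ a m (A : 'M[R]_m) c : ext_char a (c *: A) = c ^+ a * ext_char a A.
Proof.
rewrite !ext_charE big_distrr; apply: eq_bigr => I _ /=.
by rewrite -detZ; congr (\det _); apply/matrixP => i j; rewrite !mxE.
Qed.

End ExteriorCharacters.

Lemma ext_char_map (R S : comNzRingType) (f : {rmorphism R -> S}) a m (A : 'M[R]_m) :
  ext_char a (map_mx f A) = f (ext_char a A).
Proof.
rewrite !ext_charE rmorph_sum; apply: eq_bigr => I _.
by rewrite -det_map_mx; congr (\det _); apply/matrixP => i j; rewrite !mxE.
Qed.

(* The left-hand side is the reciprocal polynomial of [char_poly A]. *)
Lemma det_sub_scale_ext_char (R : comNzRingType) m (A : 'M[R]_m) :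
  \det (1%:M - 'X *: map_mx polyC A) =
  \sum_(0 <= a < m.+1) (-1) ^+ a * 'X^a * (ext_char a A)%:P.
Proof.
rewrite -scaleNr sum_ext_char; apply: eq_bigr => a _.
by rewrite ext_charZ ext_char_map (exprNn 'X).
Qed.

(** * Rotations *)

Lemma mul_mxdiag (R : comNzRingType) n (p_ : 'I_n -> nat) (A B : forall i, 'M[R]_(p_ i)) :
  \mxdiag_i A i *m \mxdiag_i B i = \mxdiag_i (A i *m B i).
Proof.
rewrite /mxdiag mul_mxdiag_mxblock; apply/eq_mxblock => i j.
by case: eqVneq => [<-|_]; rewrite ?conform_mx_id ?mulmx0.
Qed.

Lemma map_mxdiag (R S : comNzRingType) (f : {rmorphism R -> S})
    n (p_ : 'I_n -> nat) (A : forall i, 'M[R]_(p_ i)) :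
  map_mx f (\mxdiag_i A i) = \mxdiag_i (map_mx f (A i)).
Proof.
have E i j : map_mx f (if i == j then conform_mx 0 (A i) else 0 : 'M_(p_ i, p_ j)) =
             if i == j then conform_mx 0 (map_mx f (A i)) else 0.
  by case: eqVneq => [<-|_]; rewrite ?conform_mx_id ?map_mx0.
by apply/matrixP => s t; rewrite !mxE -E mxE.
Qed.

Lemma det_castmx (R : comNzRingType) m n (e e' : m = n) (A : 'M[R]_m) : \det (castmx (e, e') A) = \det A.
Proof. by case: n / e e' => e'; rewrite castmx_id. Qed.

Lemma det_mxdiag (R : comNzRingType) n (p_ : 'I_n -> nat) (A : forall i, 'M[R]_(p_ i)) :
  \det (\mxdiag_i A i) = \prod_i \det (A i).
Proof.
elim: n => [|n IHn] in p_ A *.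
  (* The matrix is generalized first because its type mentions the empty sum that is to be rewritten
     to 0. *)
  by rewrite [RHS]big_ord0; move: (mxdiag _); rewrite big_ord0 => B; rewrite det_mx00.
by rewrite mxdiag_recl det_castmx det_ublock IHn big_ord_recl.
Qed.

Lemma char_poly_mxdiag (R : comNzRingType) n (p_ : 'I_n -> nat) (A : forall i, 'M[R]_(p_ i)) :
  char_poly (\mxdiag_i A i) = \prod_i char_poly (A i).
Proof.
by rewrite /char_poly /char_poly_mx map_mxdiag -mxdiagZ -mxdiagB det_mxdiag.
Qed.

Lemma det_sub_scale_mxdiag (R : comNzRingType) n (p_ : 'I_n -> nat) (A : forall i, 'M[R]_(p_ i)) :
  \det (1%:M - 'X *: map_mx polyC (\mxdiag_i A i)) =
  \prod_i \det (1%:M - 'X *: map_mx polyC (A i)).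
Proof.
rewrite map_mxdiag -mul_scalar_mx -!mxdiagZ mul_mxdiag -mxdiagB det_mxdiag.
by under eq_bigr do rewrite mul_scalar_mx.
Qed.

Lemma det_mx22 (R : comNzRingType) (A : 'M[R]_2) :
  \det A = A 0 0 * A 1 1 - A 0 1 * A 1 0.
Proof.
rewrite (expand_det_row _ 0) !big_ord_recl big_ord0 /cofactor !det_mx11 !mxE /=.
have l1 : lift 0 (0 : 'I_1) = 1 by apply: val_inj.
have l2 : lift 1 (0 : 'I_1) = 0 :> 'I_2 by apply: val_inj.
by rewrite !l1 l2 expr0 expr1 mul1r mulN1r mulrN addr0.
Qed.

Section Rotations.
Variable R : realType.
Implicit Types (x y : R) (q n t : nat).

Lemma RotD x y : Rot (x + y) = Rot x *m Rot y.
Proof.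
apply/matrixP => i j; rewrite !mxE !big_ord_recl big_ord0 !mxE mulrDr cosD sinD.
by case: i j => [[|[]]] //= ? [[|[]]] //= ?; ring.
Qed.

Lemma Rot0 : Rot 0 = 1%:M :> 'M[R]_2.
Proof.
apply/matrixP => i j; rewrite !mxE mulr0 cos0 sin0 oppr0.
by case: i j => [[|[]]] //= ? [[|[]]].
Qed.

Lemma char_poly_Rot x :
  char_poly (Rot x) = 'X^2 - (2 * cos (2 * pi * x))%:P * 'X + 1.
Proof.
rewrite /char_poly det_mx22 !mxE /= !mulr1n !mulr0n.
have := cos2Dsin2 (2 * pi * x); move: (cos _) (sin _) => c s /(congr1 polyC).
rewrite rmorphD !rmorphXn rmorph1 rmorphM rmorphN /= => <-; ring.
Qed.

(** A rotation has determinant 1, so its quadratic characteristic polynomial is palindromic and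
    equals its reciprocal. *)
Lemma det_sub_scale_Rot x :
  \det (1%:M - 'X *: map_mx polyC (Rot x)) = char_poly (Rot x).
Proof.
rewrite char_poly_Rot det_mx22 !mxE /=.
have := cos2Dsin2 (2 * pi * x); move: (cos _) (sin _) => c s /(congr1 polyC).
rewrite rmorphD !rmorphXn rmorph1 rmorphM rmorphN /= => e.
suff -> : 'X^2 = 'X^2 * (c%:P ^+ 2 + s%:P ^+ 2) :> {poly R} by ring.
by rewrite e mulr1.
Qed.

Lemma rot_mxX q n (r : 'I_n -> int) t :
  rot_mx R q r ^+ t = \mxdiag_i Rot (t%:R * ((r i)%:~R / q%:R)).
Proof.
elim: t => [|t IHt].
  by under eq_mxdiag do rewrite mul0r Rot0; rewrite mxdiagZ.
rewrite exprS IHt -mulmxE mul_mxdiag; apply: eq_mxdiag => i.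
by rewrite -RotD mulrS mulrDl mul1r.
Qed.

(** Being palindromic block by block, the characteristic polynomial may be replaced by its
    reciprocal; this is why [ext_char a] comes with 'X^a and not with the complementary power. *)
Lemma char_poly_rot_mxX q n (r : 'I_n -> int) t :
  char_poly (rot_mx R q r ^+ t) =
  \sum_(0 <= a < (2 * n).+1)
    (-1) ^+ a * 'X^a * (ext_char a (rot_mx R q r ^+ t))%:P.
Proof.
have -> : (2 * n = \sum_(i < n) 2)%N by rewrite sum_nat_const card_ord mulnC.
rewrite -det_sub_scale_ext_char rot_mxX char_poly_mxdiag det_sub_scale_mxdiag.
by apply: eq_bigr => i _; rewrite det_sub_scale_Rot.
Qed.

Local Open Scope complex_scope.

Definition expi x : R[i] := cos (2 * pi * x) +i* sin (2 * pi * x).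

Lemma expiD x y : expi (x + y) = expi x * expi y.
Proof.
by apply/eqP; rewrite /expi eq_complex /= mulrDr cosD sinD eqxx /=; apply/eqP; ring.
Qed.

Lemma expi0 : expi 0 = 1.
Proof. by rewrite /expi mulr0 cos0 sin0. Qed.

Lemma expi_mulrn x t : expi (t%:R * x) = expi x ^+ t.
Proof.
elim: t => [|t IHt]; first by rewrite mul0r expi0.
by rewrite mulrS mulrDl mul1r expiD IHt exprS.
Qed.

Lemma expi1 : expi 1 = 1.
Proof. by rewrite /expi mulr1 mulr_natl cos2pi sin2pi. Qed.

Lemma expi_int (m : int) : expi m%:~R = 1.
Proof.
have nat1 j : expi j%:R = 1 by rewrite -[j%:R]mulr1 expi_mulrn expi1 expr1n.
case: m => j; first exact: nat1.
have := expi0; rewrite -(subrr (j.+1%:R : R)) expiD nat1 mul1r.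
by rewrite NegzE mulrNz.
Qed.

Lemma expi_prim_root q : (0 < q)%N -> q.-primitive_root (expi q%:R^-1).
Proof.
move=> q0; rewrite /primitive_root_of_unity q0; apply/forallP => j /=.
have qn0 : q%:R != 0 :> R by rewrite pnatr_eq0 -lt0n.
rewrite unity_rootE -expi_mulrn; apply/eqP.
have [->|ne] := eqVneq j.+1 q; first by rewrite mulfV // expi1 eqxx.
have lt : (j.+1 < q)%N by rewrite ltn_neqAle ne ltn_ord.
apply/negP => /eqP [+ _].
(* If the power were 1, then cos (2x) = 1 and so sin x = 0, which is impossible as 0 < x < pi. *)
set x : R := pi * (j.+1%:R / q%:R).
rewrite -mulrA mulr_natl cos_mulr2n cos2sin2 => e.
have : sin x ^+ 2 = 0 by lra.
apply/eqP; rewrite expf_eq0 /= gt_eqF // sin_gt0_pi // /x.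
rewrite mulr_gt0 ?pi_gt0 ?divr_gt0 ?ltr0n //=.
by rewrite gtr_pMr ?pi_gt0 // ltr_pdivrMr ?ltr0n // mul1r ltr_nat.
Qed.

Lemma map_char_poly_Rot x :
  map_poly (real_complex R) (char_poly (Rot x)) =
  ('X - (expi x)%:P) * ('X - (expi (- x))%:P).
Proof.
have e1 : expi x * expi (- x) = 1 by rewrite -expiD subrr expi0.
have e2 : expi x + expi (- x) = (2 * cos (2 * pi * x))%:C.
  rewrite /expi mulrN cosN sinN; apply/eqP.
  by rewrite eq_complex /= subrr eqxx andbT; apply/eqP; ring.
rewrite char_poly_Rot rmorphD rmorphB /= map_polyXn rmorphM /= map_polyX map_polyC /=.
rewrite rmorph1 -e2 -(rmorph1 polyC) -e1 rmorphM rmorphD; ring.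
Qed.

End Rotations.

(** * Units modulo q and cyclotomic polynomials *)

Lemma Euler_inverse u q : (0 < q)%N -> coprime u q ->
  exists2 v, coprime v q & (v * u = 1 %[mod q])%N.
Proof.
move=> q0 cu; exists (u ^ (totient q).-1)%N; first by rewrite coprimeXl.
by rewrite -expnSr prednK ?totient_gt0 // Euler_exp_totient.
Qed.

Lemma lift_coprime w N q : (0 < q)%N -> coprime w N -> (N %| q)%N ->
  exists2 u, coprime u q & (u = w %[mod N])%N.
Proof.
(* The lift adds to [w] the multiple of [N] by the part of [q] made of the primes not dividing [w].
   A prime factor of [q] then divides exactly one of the two summands, hence not their sum. *)
move=> q0 cw Nq; pose pi : nat_pred := [pred p | ~~ (p %| w)%N].
exists (w + N * q`_pi)%N; last by rewrite -modnDmr modnMr addn0.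
apply/idPn => ne1; rewrite /coprime in ne1; set d := gcdn _ _ in ne1.
have d1 : (1 < d)%N by rewrite ltn_neqAle eq_sym ne1 gcdn_gt0 q0 orbT.
have pp := pdiv_prime d1; have pd := pdiv_dvd d.
move: (pdiv d) pp pd => p pp; rewrite dvdn_gcd => /andP[pu pq].
have pm : (p %| q`_pi)%N = ~~ (p %| w)%N.
  have := @pi_of_part pi q q0 p; rewrite !inE /= !mem_primes part_gt0 q0 pp pq /=.
  by [].
case pw : (p %| w)%N pm => /= pm; move: pu; last by rewrite dvdn_addl ?pw // dvdn_mull.
rewrite dvdn_addr // Euclid_dvdM // pm orbF => pN.
have : (p %| gcdn w N)%N by rewrite dvdn_gcd pw.
by rewrite (eqP cw) dvdn1 => /eqP p1; rewrite p1 in pp.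
Qed.

Definition residue_fiber q N y := [set x : 'I_q | coprime x q && (x %% N == y)%N].

(** Lift y'/y modulo [N] to a unit [u] modulo [q]: multiplication by [u] is injective and sends the
    fiber over [y] into the fiber over [y']. By symmetry all fibers over units have the same
    size. *)
Lemma leq_residue_fiber q N y y' : (0 < q)%N -> (N %| q)%N ->
  coprime y N -> coprime y' N -> (y < N)%N -> (y' < N)%N ->
  (#|residue_fiber q N y| <= #|residue_fiber q N y'|)%N.
Proof.
move=> q0 Nq cy cy' yN y'N; have N0 : (0 < N)%N by apply: dvdn_gt0 Nq.
have [w cw ew] := Euler_inverse N0 cy.
have [u cu eu] : exists2 u, coprime u q & (u = y' * w %[mod N])%N.
  by apply: lift_coprime => //; rewrite coprimeMl cy'.
have [v _ ev] := Euler_inverse q0 cu.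
pose m (x : 'I_q) : 'I_q := Ordinal (ltn_pmod (u * x) q0).
have mi : injective m.
  move=> x x' /(congr1 val) /= e; apply: val_inj => /=.
  have inv (z : 'I_q) : (v * ((u * z) %% q) %% q = z)%N.
    by rewrite modnMmr mulnA -modnMml ev modnMml mul1n modn_small.
  by rewrite -(inv x) e inv.
rewrite -(card_imset _ mi); apply/subset_leq_card/subsetP => _ /imsetP[x + ->].
rewrite !inE /= => /andP[cx /eqP xy]; rewrite coprime_modl coprimeMl cu cx /=.
rewrite modn_dvdm // -modnMml eu modnMml -modnMmr xy -mulnA -modnMmr ew.
by rewrite modnMmr muln1 modn_small.
Qed.

Lemma prod_coprime_mod (R : comNzRingType) (f : nat -> R) q N :
  (0 < q)%N -> (N %| q)%N ->
  \prod_(x < q | coprime x q) f (x %% N)%N =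
  (\prod_(y < N | coprime y N) f y) ^+ (totient q %/ totient N).
Proof.
move=> q0 Nq; have N0 : (0 < N)%N by apply: dvdn_gt0 Nq.
pose h (x : 'I_q) : 'I_N := Ordinal (ltn_pmod x N0).
have hP (x : 'I_q) : coprime x q -> coprime (h x) N.
  by rewrite coprime_modl; apply: coprime_dvdr.
have [c cE] : exists c, forall y : 'I_N, coprime y N -> #|residue_fiber q N y| = c.
  (* The reference fiber is over [1 %% N] rather than 1, so that N = 1, whose only residue is 0, is
     covered. *)
  have c1 : coprime (1 %% N) N by rewrite coprime_modl coprime1n.
  exists #|residue_fiber q N (1 %% N)%N| => y cy; apply/eqP.
  by rewrite eqn_leq !leq_residue_fiber // ltn_pmod.
have tot : (totient q = c * totient N)%N.
  have tE n : totient n = \sum_(x < n | coprime x n) 1.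
    rewrite totient_count_coprime big_mkord [RHS]big_mkcond /=.
    by apply: eq_bigr => x _; rewrite coprime_sym; case: coprime.
  rewrite !tE (partition_big h (fun y => coprime y N)) //= big_distrr /=.
  apply: eq_bigr => y cy; rewrite muln1 -(cE y cy) sum1_card.
  by apply: eq_card => x; rewrite inE.
rewrite tot mulnK ?totient_gt0 // (partition_big h (fun y => coprime y N)) //= -prodrXl.
apply: eq_bigr => y cy; rewrite -(cE y cy) -prodr_const.
apply: congr_big => // [x|x]; first by rewrite !inE.
by move=> /andP[_ /eqP <-].
Qed.

(** Over the divisors of [n], both families of polynomials multiply to 'X^n - 1. By induction they
    agree at the proper divisors, and these factors cancel. *)
Lemma map_Cyclotomic (F : fieldType) n (z : F) : n.-primitive_root z ->
  map_poly intr 'Phi_n = cyclotomic z n.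
Proof.
elim/ltn_ind: n z => n IHn z pz; have n0 := prim_order_gt0 pz.
have nn : n \in divisors n by rewrite -dvdn_divisors.
have := prod_cyclotomic pz.
have := congr1 (map_poly (intr : int -> F)) (prod_Cyclotomic n0).
rewrite rmorph_prod rmorphB /= map_polyXn rmorph1 => <-.
rewrite !(bigD1_seq n) ?divisors_uniq //= divnn n0 expr1.
set P := \prod_(d <- _ | _) _; set Q := \prod_(d <- _ | _) _.
have -> : P = Q.
  rewrite /P /Q big_seq_cond [RHS]big_seq_cond; apply: eq_bigr => d /andP[dn ne].
  rewrite -dvdn_divisors // in dn.
  by rewrite (IHn d _ (z ^+ (n %/ d))) ?dvdn_prim_root // ltn_neqAle ne dvdn_leq.
have Q0 : Q != 0.
  by apply/monic_neq0/monic_prod => d _; apply: cyclotomic_monic.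
by move/(mulIf Q0).
Qed.

(** The power z^t is a primitive [N]-th root of unity, so the factor at [y] depends on [y] modulo
    [N] only and [prod_coprime_mod] applies. *)
Lemma prod_coprime_prim_root (F : fieldType) q t (z : F) : q.-primitive_root z ->
  let N := (q %/ gcdn t q)%N in
  \prod_(y < q | coprime y q) ('X - (z ^+ (y * t))%:P) =
  map_poly intr 'Phi_N ^+ (totient q %/ totient N).
Proof.
move=> pz N; have pzt : N.-primitive_root (z ^+ t) by apply: exp_prim_root.
have q0 := prim_order_gt0 pz.
have Nq : (N %| q)%N by apply/dvdn_div/dvdn_gcdr.
rewrite (map_Cyclotomic pzt) -(prod_coprime_mod (fun y => 'X - (z ^+ t ^+ y)%:P) q0 Nq).
by apply: eq_bigr => y _; rewrite (prim_expr_mod pzt) -exprM mulnC.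
Qed.

(** * Representation of the units modulo q by the defining sets and their opposites *)

Definition residue (q : nat) (x : int) : nat := `|(x %% q%:Z)%Z|%N.

Lemma residueE q x : (0 < q)%N -> (residue q x)%:Z = (x %% q%:Z)%Z.
Proof. by move=> q0; rewrite gez0_abs // modz_ge0 // eqz_nat -lt0n. Qed.

Lemma ltn_residue q x : (0 < q)%N -> (residue q x < q)%N.
Proof. by move=> q0; rewrite -ltz_nat residueE // ltz_pmod // ltz_nat. Qed.

Lemma coprime_residue q x : (0 < q)%N -> coprime (residue q x) q = coprime `|x| q.
Proof.
move=> q0; rewrite -[RHS]/(coprimez x q%:Z) /coprimez -gcdz_modl -residueE //.
Qed.

(** Two elements of absolute value below q/2 differ by less than [q]. *)
Lemma residue_inj q : (0 < q)%N -> {in RP q &, injective (residue q)}.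
Proof.
move=> q0 x y /andP[xq _] /andP[yq _] e.
have : (x == y %[mod q%:Z])%Z by rewrite -!residueE // e.
rewrite eqz_mod_dvd dvdzE /= => d.
have [xy|ne] := eqVneq x y; first by [].
have : (q <= `|(x - y)%R|)%N by apply: dvdn_leq => //; rewrite absz_gt0 subr_eq0.
by lia.
Qed.

Lemma expi_residue (R : realType) q x : (0 < q)%N ->
  expi (x%:~R / q%:R : R) = expi q%:R^-1 ^+ residue q x.
Proof.
move=> q0; have qn0 : q%:R != 0 :> R by rewrite pnatr_eq0 -lt0n.
rewrite -expi_mulrn {1}(divz_eq x q) -residueE // rmorphD rmorphM /=.
by rewrite mulrDl mulfK // expiD expi_int mul1r.
Qed.

Section SignedUnits.
Variables (n k q : nat) (r : 'I_n -> int) (s : 'I_k -> int).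
Hypotheses (q0 : (0 < q)%N) (hq : totient q = (2 * n + 2 * k)%N)
  (hrs : defining_sets q r s).

Definition signed_units : seq int :=
  [seq r i | i <- enum 'I_n] ++ [seq - r i | i <- enum 'I_n] ++
  [seq s j | j <- enum 'I_k] ++ [seq - s j | j <- enum 'I_k].

Lemma signed_units_RP : {subset signed_units <= RP q}.
Proof.
have [[_ rP _] [_ sP _] _] := hrs.
move=> x; rewrite !mem_cat => /or4P[] /mapP[i _ ->]; rewrite ?rP ?sP //.
  by have := rP i; rewrite !inE abszN.
by have := sP i; rewrite !inE abszN.
Qed.

Lemma signed_units_uniq : uniq signed_units.
Proof.
have [[rI _ rN] [sI _ sN] rs] := hrs.
have half m (f : 'I_m -> int) : injective f ->
    (forall i j, (f i != - f j %[mod q%:Z])%Z) ->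
    uniq ([seq f i | i <- enum 'I_m] ++ [seq - f i | i <- enum 'I_m]).
  move=> fI fN; rewrite cat_uniq; apply/and3P; split.
  - by rewrite map_inj_uniq // enum_uniq.
  - apply/hasPn => _ /mapP[j _ ->]; apply/mapP => -[i _ e].
    by have := fN i j; rewrite e eqxx.
  - by rewrite map_inj_uniq ?enum_uniq // => i j /oppr_inj/fI.
rewrite /signed_units catA cat_uniq !half // andbT.
apply/hasPn => x xs; apply/negP => xr.
have {xr}[i xr] : exists i, x = r i \/ x = - r i.
  by move: xr; rewrite mem_cat => /orP[] /mapP[i _ ->]; exists i; [left | right].
have {xs}[j xs] : exists j, x = s j \/ x = - s j.
  by move: xs; rewrite mem_cat => /orP[] /mapP[j _ ->]; exists j; [left | right].
have [/eqP n1 /eqP n2] := rs i j.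
case: xr xs => -> [] e; [apply: n1 | apply: n2 | apply: n2 | apply: n1] => //.
- by rewrite e opprK.
by apply: oppr_inj.
Qed.

(** The residues are distinct units, and there are 2n + 2k = Phi(q) of them, so every unit
    occurs. *)
Lemma perm_residue_signed_units :
  perm_eq [seq residue q x | x <- signed_units] [seq y <- index_iota 0 q | coprime y q].
Proof.
have u1 : uniq [seq residue q x | x <- signed_units].
  rewrite map_inj_in_uniq ?signed_units_uniq // => x y xs ys.
  by apply: residue_inj; rewrite // signed_units_RP.
have u2 : uniq [seq y <- index_iota 0 q | coprime y q] by rewrite filter_uniq ?iota_uniq.
have sz m (f : 'I_m -> int) : size [seq f i | i <- enum 'I_m] = m.
  by rewrite size_map size_enum_ord.
apply: uniq_perm => //.
suff /(uniq_min_size u1)[] : {subset [seq residue q x | x <- signed_units] <=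
    [seq y <- index_iota 0 q | coprime y q]}.
- rewrite size_filter -sum1_count size_map !size_cat !sz.
  rewrite big_mkord.
  have -> : \sum_(y < q | coprime y q) 1 = totient q.
    rewrite totient_count_coprime big_mkord big_mkcond /=.
    by apply: eq_bigr => y _; rewrite coprime_sym; case: coprime.
  by rewrite hq; lia.
- by [].
move=> _ /mapP[x /signed_units_RP /andP[_ cx] ->].
by rewrite mem_filter mem_index_iota coprime_residue // cx ltn_residue.
Qed.

End SignedUnits.

(** With w = exp(2 i pi / q), the eigenvalues of the two matrices are together the w^(xt) for [x] in
    [signed_units], that is, for [x] over all units modulo [q]. *)
Lemma char_poly_rot_pair (R : realType) n k q (r : 'I_n -> int) (s : 'I_k -> int) t :
  (0 < q)%N -> totient q = (2 * n + 2 * k)%N -> defining_sets q r s ->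
  let N := (q %/ gcdn t q)%N in
  char_poly (rot_mx R q r ^+ t) * char_poly (rot_mx R q s ^+ t) =
  Psi R N ^+ (totient q %/ totient N).
Proof.
(* The identity is checked over the complex numbers, where the rotation blocks have linear
   factors. *)
move=> q0 hq hrs N; apply: (map_poly_inj (real_complex R)).
have pz := expi_prim_root R q0.
rewrite rmorphM rmorphXn /= /Psi -map_poly_comp.
rewrite (eq_map_poly (g := intr)); last by move=> x; rewrite /= rmorph_int.
rewrite -(prod_coprime_prim_root t pz) !rot_mxX !char_poly_mxdiag.
pose F y := 'X - (expi (q%:R^-1 : R) ^+ (y * t))%:P.
have half m (f : 'I_m -> int) :
    map_poly (real_complex R) (\prod_i char_poly (Rot (t%:R * ((f i)%:~R / q%:R)))) =
    \prod_(x <- [seq f i | i <- enum 'I_m] ++ [seq - f i | i <- enum 'I_m])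
      F (residue q x).
  rewrite big_cat (big_map f) (big_map (fun i => - f i)) !big_enum /= rmorph_prod -big_split /=.
  apply: eq_bigr => i _; rewrite map_char_poly_Rot -mulrN -mulNr -mulrNz.
  by rewrite !expi_mulrn !expi_residue // /F !exprM.
rewrite !half -big_cat /= -catA.
rewrite -(big_map (residue q) xpredT F) (perm_big _ (perm_residue_signed_units q0 hq hrs)).
by rewrite big_filter big_mkord.
Qed.

(** * The generating function *)

Lemma sum_nat_widen (V : nmodType) (F : nat -> V) l m n : (m <= n)%N ->
  \sum_(l <= i < m) F i = \sum_(0 <= i < n | (l <= i < m)%N) F i.
Proof.
by move=> mn; rewrite [LHS](big_nat_widenl _ 0) // [LHS](big_nat_widen _ _ n).
Qed.

(** Reindexing by d = a + b: the bound b <= p becomes the truncated lower bound [d - p] on [a], and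
    b >= 0 becomes a <= d. *)
Lemma sum_antidiagonal (V : nmodType) p m (G : nat -> nat -> V) :
  \sum_(0 <= b < p.+1) \sum_(0 <= a < m.+1) G b a =
  \sum_(0 <= d < (m + p).+1) \sum_(d - p <= a < (minn m d).+1) G (d - a)%N a.
Proof.
have inner d : \sum_(d - p <= a < (minn m d).+1) G (d - a)%N a =
    \sum_(0 <= a < m.+1) if (a <= d <= a + p)%N then G (d - a)%N a else 0.
  rewrite -big_mkcond (sum_nat_widen _ _ (n := m.+1)) ?ltnS ?geq_minl //.
  rewrite big_nat_cond [RHS]big_nat_cond; apply: eq_bigl => a /=.
  by apply/idP/idP; lia.
rewrite (eq_bigr _ (fun d _ => inner d)) exchange_big [RHS]exchange_big /=.
rewrite big_nat_cond [RHS]big_nat_cond; apply: eq_bigr => a; rewrite andbT => /andP[_ am].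
rewrite -big_mkcond /=.
transitivity (\sum_(a <= d < (a + p).+1) G (d - a)%N a).
  rewrite -{2}[a]add0n big_addn -addnS addKn.
  by apply: eq_bigr => b _; rewrite addnK.
rewrite (sum_nat_widen _ _ (n := (m + p).+1)); last by lia.
rewrite big_nat_cond [RHS]big_nat_cond; apply: eq_bigl => d /=.
by apply/idP/idP; lia.
Qed.

(** The two terms of z^-b - z^(b+2) are treated apart. Reversing [b] into p - b in the first one
    makes both exponents depend on d = a + b only: they are c = d - p and c = d + 2. *)
Lemma sum_collect_exponents (F : fieldType) (z : F) p m (X : nat -> nat -> F) :
  z != 0 ->
  \sum_(0 <= b < p.+1) \sum_(0 <= a < m.+1)
    (-1) ^+ b * (z ^- b - z ^+ (b + 2)) * ((-1) ^+ a * z ^+ a * X (p - b)%N a) =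
  \sum_(0 <= d < (m + p).+1)
     ((-1) ^ (d%:Z - p%:Z) * z ^ (d%:Z - p%:Z) *
      \sum_(d - p <= a < (minn m d).+1) X (d - a)%N a)
  + \sum_(2 <= c < (m + p + 2).+1)
      (-1) ^+ c.+1 * z ^+ c *
      \sum_(c - 2 - p <= a < (minn m (c - 2)).+1) X (p + 2 + a - c)%N a.
Proof.
move=> z0.
pose A b a := (-1) ^ (b%:Z + a%:Z - p%:Z) * z ^ (b%:Z + a%:Z - p%:Z) * X b a.
pose B b a := (-1) ^+ (b + a).+1 * z ^+ (b + a + 2) * X (p - b)%N a.
transitivity (\sum_(0 <= b < p.+1) \sum_(0 <= a < m.+1) A b a +
              \sum_(0 <= b < p.+1) \sum_(0 <= a < m.+1) B b a).
  rewrite [X in X + _]big_nat_rev /= -big_split; apply: eq_big_nat => b /andP[_ bp].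
  rewrite -big_split; apply: eq_bigr => a _ /=.
  rewrite add0n subSS /A /B.
  have -> : (p - b)%N%:Z + a%:Z - p%:Z = - b%:Z + a%:Z by lia.
  have m1 : (-1) ^ (- b%:Z + a%:Z) = (-1) ^+ b * (-1) ^+ a :> F.
    by rewrite expfzDr ?oppr_eq0 ?oner_eq0 // -exprnN -!exprnP -exprVn invrN1.
  rewrite m1 expfzDr // -exprnN -exprnP [(-1) ^+ _.+1]exprS !exprD; ring.
rewrite !sum_antidiagonal; congr (_ + _).
  apply: eq_bigr => d _; rewrite big_distrr /=; apply: eq_big_nat => a /andP[_ ad].
  by rewrite /A; have -> : (d - a)%N%:Z + a%:Z - p%:Z = d%:Z - p%:Z by lia.
rewrite [RHS](big_addn 0 _ 2).
have -> : ((m + p + 2).+1 - 2 = (m + p).+1)%N by lia.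
apply: eq_bigr => d _.
rewrite !addnK big_distrr /=; apply: eq_big_nat => a /andP[_ ad].
have {}ad : (a <= d)%N by lia.
rewrite /B subnK // addn2 -[(-1) ^+ d.+3]/(-1 * (-1 * _)) mulrA mulrNN mul1r mul1r.
by congr (_ * X _ _); lia.
Qed.

Lemma sum_index_partition (V : nmodType) (f : nat -> nat) (ds s : seq nat) (X : nat -> V) :
  uniq ds -> (forall t, t \in s -> f t \in ds) ->
  \sum_(t <- s) X t = \sum_(d <- ds) \sum_(t <- s | f t == d) X t.
Proof.
move=> u sub; under [RHS]eq_bigr do rewrite big_mkcond.
rewrite exchange_big /= big_seq [RHS]big_seq; apply: eq_bigr => t ts.
rewrite (bigD1_seq (f t)) ?sub //= eqxx big1 ?addr0 // => d ne.
by rewrite eq_sym (negbTE ne).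
Qed.

Section GeneratingFunction.
Variable R : realType.
Notation z := (zvar R).

Lemma zvar_neq0 : z != 0.
Proof. by rewrite tofrac_eq0 polyX_eq0. Qed.

Variables (p q n k : nat) (r : 'I_n -> int) (s : 'I_k -> int).

Definition char_prod t a b : ratfun R :=
  cstF (ext_char a (rot_mx R q r ^+ t) * ext_char b (rot_mx R q s ^+ t)).

(* The contribution of [g ^ t] to the numerator of the generating function, over
   the denominator [det (z - g ^ t) det (z - gbar ^ t)]. *)
Definition numer t : ratfun R :=
  \sum_(0 <= b < p.+1) \sum_(0 <= a < (2 * k).+1)
    (-1) ^+ b * (z ^- b - z ^+ (b + 2)) * ((-1) ^+ a * z ^+ a * char_prod t (p - b) a).

Lemma char_sumE T a b : char_sum R q r s T a b = \sum_(t <- T) char_prod t a b.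
Proof. by rewrite /char_sum /char_prod /cstF /polyF !rmorph_sum. Qed.

Lemma numerE t :
  numer t =
  \sum_(0 <= d < (2 * k + p).+1)
     ((-1) ^ (d%:Z - p%:Z) * z ^ (d%:Z - p%:Z) *
      \sum_(d - p <= a < (minn (2 * k) d).+1) char_prod t (d - a) a)
  + \sum_(2 <= c < (2 * k + p + 2).+1)
      (-1) ^+ c.+1 * z ^+ c *
      \sum_(c - 2 - p <= a < (minn (2 * k) (c - 2)).+1)
         char_prod t (p + 2 + a - c) a.
Proof. exact: sum_collect_exponents zvar_neq0. Qed.

(** This shows that [P_sum] is additive in [T]; from here on only the grouping of the indices [t]
    matters. *)
Lemma P_sumE T : P_sum R p q r s T = \sum_(t <- T) numer t.
Proof.
rewrite (eq_bigr _ (fun t _ => numerE t)) big_split /=; congr (_ + _).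
  rewrite exchange_big; apply: eq_bigr => d _ /=; rewrite -big_distrr /=; congr (_ * _).
  by rewrite exchange_big; apply: eq_bigr => a _; rewrite char_sumE.
rewrite exchange_big; apply: eq_bigr => d _ /=; rewrite -big_distrr /=; congr (_ * _).
by rewrite exchange_big; apply: eq_bigr => a _; rewrite char_sumE.
Qed.

(** By [char_poly_rot_pair] this is the product of the characteristic polynomials of g^t and gbar^t,
    in a form free of [r] and [s] that depends on [gcdn t q] only. *)
Definition denom t : ratfun R :=
  let N := (q %/ gcdn t q)%N in polyF (Psi R N ^+ (totient q %/ totient N)).

Lemma Psi_neq0 N : Psi R N != 0.
Proof. exact/monic_neq0/monic_map/Cyclotomic_monic. Qed.

Lemma denom_neq0 t : denom t != 0.
Proof. by rewrite tofrac_eq0 expf_neq0 // Psi_neq0. Qed.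

Lemma polyF_neq0 (f : {poly R}) : f \is monic -> polyF f != 0.
Proof. by move=> fm; rewrite tofrac_eq0 monic_neq0. Qed.

Hypotheses (q0 : (0 < q)%N) (hq : totient q = (2 * n + 2 * k)%N)
  (hrs : defining_sets q r s).

(** The fraction is expanded by the characteristic polynomial of gbar^t, which [char_poly_rot_mxX]
    writes as an alternating sum of characters. *)
Lemma ext_char_div_char_poly t c :
  cstF (ext_char c (rot_mx R q r ^+ t)) / polyF (char_poly (rot_mx R q r ^+ t)) =
  (\sum_(0 <= a < (2 * k).+1) (-1) ^+ a * z ^+ a * char_prod t c a) / denom t.
Proof.
rewrite /denom -(char_poly_rot_pair R t q0 hq hrs) /=.
set A := char_poly (rot_mx R q r ^+ t); set B := char_poly (rot_mx R q s ^+ t).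
have A0 : polyF A != 0 by apply/polyF_neq0/char_poly_monic.
have B0 : polyF B != 0 by apply/polyF_neq0/char_poly_monic.
have -> : \sum_(0 <= a < (2 * k).+1) (-1) ^+ a * z ^+ a * char_prod t c a =
    cstF (ext_char c (rot_mx R q r ^+ t)) * polyF B.
  rewrite /B char_poly_rot_mxX /polyF rmorph_sum big_distrr; apply: eq_bigr => a _ /=.
  rewrite /char_prod /cstF /polyF !rmorphM rmorphXn rmorphN1 rmorphXn /=.
  by rewrite mulrCA.
rewrite [polyF (A * B)]rmorphM /= -/(polyF A) -/(polyF B).
by rewrite invfM mulrACA divff // mulr1.
Qed.

Lemma genfunE :
  genfun R p q r = q%:R^-1 * (\sum_(1 <= t < q.+1) numer t / denom t)
                   + (-1) ^+ p.+1 * z ^- p.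
Proof.
congr (_ * _ + _); under [RHS]eq_bigr do rewrite mulr_suml.
rewrite [RHS]exchange_big /=; apply: eq_bigr => b _.
rewrite big_distrr /=; apply: eq_bigr => t _.
by rewrite -big_distrr ext_char_div_char_poly mulrA.
Qed.

End GeneratingFunction.

Lemma affine_eq (F : fieldType) (a b c x y : F) : a != 0 ->
  a * (x + b) + c = a * (y + b) + c <-> x = y.
Proof. by move=> a0; split=> [/addIr/(mulfI a0)/addIr | ->]. Qed.

(** * Comparison of two choices of the defining set *)

Section Comparison.
Variables (R : realType) (p q n k : nat) (r r' : 'I_n -> int) (s s' : 'I_k -> int).
Hypotheses (q0 : (0 < q)%N) (hq : totient q = (2 * n + 2 * k)%N)
  (hrs : defining_sets q r s) (hrs' : defining_sets q r' s').

Lemma rot_mxX_order m (f : 'I_m -> int) : rot_mx R q f ^+ q = 1.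
Proof.
have qn0 : q%:R != 0 :> R by rewrite pnatr_eq0 -lt0n.
rewrite rot_mxX -[RHS]mxdiagZ; apply: eq_mxdiag => i.
rewrite mulrCA divff // mulr1; have := expi_int R (f i); rewrite /expi => -[c1 s0].
apply/matrixP => a b; rewrite !mxE c1 s0 oppr0.
by case: a b => [[|[]]] //= ? [[|[]]].
Qed.

Lemma numer_order : numer R p q r s q = numer R p q r' s' q.
Proof. by rewrite /numer /char_prod !rot_mxX_order. Qed.

(** The index t = q is left out: by [numer_order] its term is the same for all choices. *)
Definition gcd_numer (f : 'I_n -> int) (h : 'I_k -> int) d : ratfun R :=
  \sum_(1 <= t < q | gcdn t q == d) numer R p q f h t.

Lemma P_sum_gcd (f : 'I_n -> int) (h : 'I_k -> int) d T :
  uniq T -> T =i [seq t <- index_iota 1 q | gcdn t q == d] ->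
  P_sum R p q f h T = gcd_numer f h d.
Proof.
move=> uT eT; rewrite P_sumE /gcd_numer -[RHS]big_filter; apply/perm_big/uniq_perm => //.
by rewrite filter_uniq ?iota_uniq.
Qed.

(** Each generating function is the same affine function, of slope 1/q, of its sum over the gcd
    classes; the term t = q goes into the constant. *)
Lemma genfun_eq_gcd (ds : seq nat) : uniq ds ->
  (forall t, (0 < t < q)%N -> gcdn t q \in ds) ->
  genfun R p q r = genfun R p q r' <->
  \sum_(d <- ds) gcd_numer r s d / denom R q d =
  \sum_(d <- ds) gcd_numer r' s' d / denom R q d.
Proof.
move=> u sub.
have E f h (H : defining_sets q f h) : genfun R p q f =
    q%:R^-1 * (\sum_(d <- ds) gcd_numer f h d / denom R q d +
               numer R p q f h q / denom R q q) + (-1) ^+ p.+1 * zvar R ^- p.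
  rewrite (genfunE R p q0 hq H); congr (_ * _ + _).
  transitivity (\sum_(1 <= t < q) numer R p q f h t / denom R q t +
                numer R p q f h q / denom R q q); first exact: big_nat_recr.
  congr (_ + _).
  apply: etrans (sum_index_partition (f := gcdn^~ q) _ u _) _.
    by move=> t; rewrite mem_index_iota => /sub.
  apply: eq_bigr => d _; rewrite big_distrl /=; apply: eq_bigr => t /eqP <-.
  (* The denominators at [t] and at [gcdn t q] coincide because taking the gcd with [q] is
     idempotent. *)
  by rewrite /denom -gcdnA gcdnn.
have q1 : (q%:R^-1 : ratfun R) != 0.
  rewrite invr_eq0 -(rmorph_nat (@tofrac {poly R})) tofrac_eq0.
  by rewrite -polyC_natr polyC_eq0 pnatr_eq0 -lt0n.
rewrite (E _ _ hrs) (E _ _ hrs') numer_order.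
exact: affine_eq.
Qed.

End Comparison.

(** * Gcd classes and cyclotomic polynomials for prime powers *)

Lemma gcdn_prime_power_image pr e i : prime pr -> (i <= e)%N ->
  [seq t <- index_iota 1 (pr ^ e) | gcdn t (pr ^ e) == (pr ^ i)%N] =i
  [seq (t * pr ^ i)%N | t <- index_iota 1 (pr ^ (e - i)) & coprime t (pr ^ (e - i))].
Proof.
move=> hp ie t; have pi0 : (0 < pr ^ i)%N by rewrite expn_gt0 prime_gt0.
rewrite mem_filter mem_index_iota -{1 2}(subnK ie) expnD.
apply/andP/mapP => [[/eqP g /andP[t0 tq]]|[u + ->]].
  have /dvdnP[u tu] : (pr ^ i %| t)%N by rewrite -g dvdn_gcdl.
  exists u => //; rewrite mem_filter mem_index_iota; subst t.
  rewrite -muln_gcdl in g; move/eqP: g; rewrite -[X in _ == X]mul1n eqn_pmul2r // => g.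
  by move: t0 tq; rewrite muln_gt0 ltn_pmul2r // => /andP[-> _] ->; rewrite /coprime g.
rewrite mem_filter mem_index_iota => /andP[/eqP cu /andP[u0 uq]].
by rewrite -muln_gcdl cu mul1n eqxx muln_gt0 u0 pi0 ltn_pmul2r.
Qed.

Lemma gcdn_prime_power_mem pr e t : prime pr -> (0 < t < pr ^ e)%N ->
  gcdn t (pr ^ e) \in [seq (pr ^ i)%N | i <- iota 0 e].
Proof.
move=> hp /andP[t0 te].
have /(dvdn_pfactor _ _ hp)[i ie gi] := dvdn_gcdr t (pr ^ e).
rewrite gi map_f // mem_iota add0n /= ltn_neqAle ie andbT; apply/negP => /eqP ei.
have : (pr ^ e %| t)%N by rewrite -{1}ei -gi dvdn_gcdl.
by move/(dvdn_leq t0); rewrite leqNgt te.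
Qed.

(** The products of cyclotomic polynomials for two consecutive powers of [pr] differ by one factor.
    Comparing this with the case e = 0 at 'X^(pr ^ e), both sides times 'X^(pr ^ e) - 1 give 'X^(pr
    ^ e.+1) - 1. *)
Lemma Cyclotomic_prime_power pr e : prime pr ->
  'Phi_(pr ^ e.+1) = 'Phi_pr \Po 'X^(pr ^ e).
Proof.
move=> hp; have pe0 j : (0 < pr ^ j)%N by rewrite expn_gt0 prime_gt0.
have Xn1 m : (0 < m)%N -> 'X^m - 1 != 0 :> {poly int}.
  by move=> m0; apply/monic_neq0/monicXnsubC.
apply: (mulIf (Xn1 _ (pe0 e))).
have dv j : perm_eq (divisors (pr ^ j)) [seq (pr ^ i)%N | i <- iota 0 j.+1].
  apply: uniq_perm; rewrite ?divisors_uniq //.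
    by rewrite map_inj_uniq ?iota_uniq //; apply: expnI; apply: prime_gt1.
  move=> d; rewrite -dvdn_divisors //; apply/(dvdn_pfactor _ _ hp)/mapP; case=> i.
    by move=> ij ->; exists i; rewrite // mem_iota ltnS.
  by rewrite mem_iota ltnS => ij ->; exists i.
have tel j : 'Phi_(pr ^ j.+1) * ('X^(pr ^ j) - 1) = 'X^(pr ^ j.+1) - 1.
  rewrite -!prod_Cyclotomic // !(perm_big _ (dv _)) -[j.+2]addn1 iotaD map_cat big_cat /=.
  by rewrite big_seq1 mulrC.
rewrite tel expnS exprM -[RHS]/(_ * ('X^(pr ^ e) - 1)).
have := tel 0; rewrite expn1 expn0 => /(congr1 (fun f => f \Po 'X^(pr ^ e))).
by rewrite rmorphM !rmorphB !rmorphXn /= comp_polyX rmorph1 -exprM mulnC exprM => ->.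
Qed.

Lemma Psi_prime_power (R : realType) pr e : prime pr ->
  Psi R pr \Po 'X^(pr ^ e) = Psi R (pr ^ e.+1).
Proof.
by move=> hp; rewrite /Psi Cyclotomic_prime_power // map_comp_poly map_polyXn.
Qed.

(** * Clearing denominators *)

Lemma denom_dvdn (R : realType) q d : (d %| q)%N ->
  denom R q d = polyF (Psi R (q %/ d) ^+ (totient q %/ totient (q %/ d))).
Proof. by move=> /gcdn_idPl dq; rewrite /denom dq. Qed.

Lemma coprime_ltn_prime pr t : prime pr -> (0 < t < pr)%N -> coprime t pr.
Proof.
move=> hp /andP[t0 tp]; rewrite coprime_sym prime_coprime //.
by apply: contraL tp => /(dvdn_leq t0); rewrite leqNgt.
Qed.

Lemma filter_coprime_ltn_prime pr : prime pr ->
  [seq t <- index_iota 1 pr | coprime t pr] = index_iota 1 pr.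
Proof.
move=> hp; apply/all_filterP/allP => t; rewrite mem_index_iota.
exact: coprime_ltn_prime.
Qed.

(** Here t = u q1 with 0 < u < q2, so [u] is prime to [q2]. *)
Lemma gcdn_two_primes q1 q2 t : prime q1 -> prime q2 -> (0 < t < q1 * q2)%N ->
  gcdn t q1 != 1%N -> gcdn t (q1 * q2) = q1.
Proof.
move=> p1 p2 /andP[t0 tq]; rewrite -/(coprime t q1) coprime_sym prime_coprime // negbK.
case/dvdnP=> u tu; subst t; move: t0 tq; rewrite muln_gt0 (mulnC q1 q2).
rewrite ltn_pmul2r ?(prime_gt0 p1) // => /andP[u0 _] uq.
rewrite -muln_gcdl.
have /eqP -> : coprime u q2 by rewrite coprime_ltn_prime // u0.
by rewrite mul1n.
Qed.

Lemma common_denominator2 (F : fieldType) (e0 e1 x0 x1 : F) : e0 != 0 -> e1 != 0 ->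
  e1 * x0 + e0 * x1 = e0 * e1 * (x0 / e0 + x1 / e1).
Proof. by move=> ? ?; field; apply/andP. Qed.

Lemma common_denominator3 (F : fieldType) (e0 e1 e2 x0 x1 x2 : F) :
  e0 != 0 -> e1 != 0 -> e2 != 0 ->
  e1 * e2 * x0 + e0 * e2 * x1 + e0 * e1 * x2 =
  e0 * e1 * e2 * (x0 / e0 + (x1 / e1 + x2 / e2)).
Proof. by move=> ? ? ?; field; apply/and3P. Qed.

Section Numerators.
Variables (R : realType) (p n k : nat) (r : 'I_n -> int) (s : 'I_k -> int).

Lemma P_sum_prime_power pr e i (T : seq nat) : prime pr -> (i < e)%N ->
  T = [seq (t * pr ^ i)%N | t <- index_iota 1 (pr ^ (e - i)) & coprime t pr] ->
  P_sum R p (pr ^ e)%N r s T = gcd_numer R p (pr ^ e)%N r s (pr ^ i)%N.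
Proof.
move=> hp ie ->; have pi0 : (0 < pr ^ i)%N by rewrite expn_gt0 prime_gt0.
apply: P_sum_gcd => [|t].
  rewrite map_inj_uniq ?filter_uniq ?iota_uniq // => x y /eqP.
  by rewrite eqn_pmul2r // => /eqP.
rewrite (gcdn_prime_power_image hp (ltnW ie)).
congr (t \in map _ _); apply: eq_filter => x.
by rewrite coprime_pexpr // subn_gt0.
Qed.

(** In this case the index set contains t = q, hence the additional numerator at [q]. The right-hand
    side, with its final 0, has the shape required by [affine_eq]. *)
Lemma Ktilde_primeE q : prime q ->
  Ktilde_prime R p q r s =
  denom R q 1 * (\sum_(d <- [:: 1%N]) gcd_numer R p q r s d / denom R q d +
                 numer R p q r s q / denom R q 1) + 0.
Proof.
move=> hq; rewrite big_seq1 addr0 mulrDr !(mulrC (denom R q 1)) !divfK ?denom_neq0 //.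
rewrite -[q]expn1 -(@P_sum_prime_power q 1 0 (index_iota 1 q)) //; last first.
  rewrite subn0 expn1 filter_coprime_ltn_prime // -[LHS]map_id.
  by apply: eq_map => t; rewrite expn0 muln1.
rewrite expn1 /Ktilde_prime !P_sumE; apply: big_nat_recr; exact: prime_gt0.
Qed.

(** For d = 1, q1, q2 the quotient q/d is q, q2, q1, and Phi(q) / Phi(q/d) is 1, q1 - 1, q2 - 1.
    Each coefficient of [Ktilde_two_primes] is the product of the other two denominators. *)
Lemma Ktilde_two_primesE q1 q2 : prime q1 -> prime q2 -> q1 <> q2 ->
  let q := (q1 * q2)%N in
  Ktilde_two_primes R p q1 q2 r s =
  denom R q 1 * denom R q q1 * denom R q q2 *
  \sum_(d <- [:: 1%N; q1; q2]) gcd_numer R p q r s d / denom R q d.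
Proof.
move=> p1 p2 ne q; rewrite !big_cons big_nil addr0.
rewrite -common_denominator3 ?denom_neq0 // /Ktilde_two_primes -/q.
have c12 : coprime q1 q2 by rewrite prime_coprime // dvdn_prime2 //; apply/eqP.
have q10 := prime_gt0 p1; have q20 := prime_gt0 p2.
have tq : totient q = (q1.-1 * q2.-1)%N by rewrite totient_coprime // !totient_prime.
have d0 : denom R q 1 = polyF (Psi R q).
  by rewrite denom_dvdn // divn1 divnn totient_gt0 muln_gt0 q10 q20 expr1.
have d1 : denom R q q1 = polyF (Psi R q2 ^+ (q1 - 1)).
  rewrite denom_dvdn ?dvdn_mulr // mulKn // tq (totient_prime p2) mulnK ?subn1 //.
  by rewrite -ltnS prednK // prime_gt1.
have d2 : denom R q q2 = polyF (Psi R q1 ^+ (q2 - 1)).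
  rewrite denom_dvdn ?dvdn_mull // mulnK // tq (totient_prime p1) mulKn ?subn1 //.
  by rewrite -ltnS prednK // prime_gt1.
(* Stated for two arbitrary primes so as to serve for both [q1] and [q2]. *)
have sz t a b : prime a -> prime b -> (0 < t < a * b)%N ->
    (gcdn t a != 1%N) = (gcdn t (a * b) == a).
  move=> pa pb tab; apply/idP/eqP => [/(gcdn_two_primes pa pb tab)//|g].
  have /gcdn_idPr -> : (a %| t)%N by rewrite -g dvdn_gcdl.
  by rewrite gtn_eqF // prime_gt1.
have uf P : uniq [seq t <- index_iota 1 q | P t] by rewrite filter_uniq ?iota_uniq.
rewrite d0 d1 d2 /polyF !rmorphM /= -!/(polyF _).
rewrite (P_sum_gcd _ _ _ _ (d := 1) (uf _)) //.
rewrite (P_sum_gcd _ _ _ _ (d := q1) (uf _)); last first.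
  move=> t; rewrite !mem_filter mem_index_iota; apply: andb_id2r => tq'.
  exact: sz.
rewrite (P_sum_gcd _ _ _ _ (d := q2) (uf _)); last first.
  move=> t; rewrite !mem_filter mem_index_iota; apply: andb_id2r => tq'.
  by rewrite /q mulnC; apply: sz; rewrite // mulnC.
by rewrite [X in X * _ + _ + _]mulrC.
Qed.

(** The exponents Phi(q) / Phi(q/d) are 1 for d = 1 and q1 for d = q1. *)
Lemma Ktilde_prime_squareE q1 : prime q1 ->
  let q := (q1 ^ 2)%N in
  Ktilde_prime_square R p q1 r s =
  denom R q 1 * denom R q q1 *
  \sum_(d <- [:: 1%N; q1]) gcd_numer R p q r s d / denom R q d.
Proof.
move=> hp q; rewrite !big_cons big_nil addr0.
rewrite -common_denominator2 ?denom_neq0 // /Ktilde_prime_square -/q.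
have q10 := prime_gt0 hp.
have d0 : denom R q 1 = polyF (Psi R q1 \Po 'X^q1).
  rewrite denom_dvdn // divn1 divnn totient_gt0 expn_gt0 q10 expr1.
  by rewrite -[in 'X^q1](expn1 q1) Psi_prime_power.
have d1 : denom R q q1 = polyF (Psi R q1 ^+ q1).
  rewrite denom_dvdn ?dvdn_mulr // mulKn // totient_pfactor // totient_prime //.
  by rewrite expn1 mulKn // -ltnS prednK // prime_gt1.
rewrite d0 d1 (@P_sum_prime_power q1 2 0) //; last first.
  rewrite subn0 -[LHS]map_id; rewrite (eq_map (g := id)) => [|t]; last first.
    by rewrite expn0 muln1.
  by congr map; apply: eq_filter => t; rewrite -/(coprime t q) /q coprime_pexpr.
rewrite (@P_sum_prime_power q1 2 1) // subn1 expn1.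
by rewrite filter_coprime_ltn_prime.
Qed.

(** The exponents Phi(q) / Phi(q/d) are 1, q1 and q1^2 for d = 1, q1 and q1^2; [Psi_prime_power]
    rewrites the polynomials at q1^3 and q1^2. *)
Lemma Ktilde_prime_cubeE q1 : prime q1 ->
  let q := (q1 ^ 3)%N in
  Ktilde_prime_cube R p q1 r s =
  denom R q 1 * denom R q q1 * denom R q (q1 ^ 2)%N *
  \sum_(d <- [:: 1; q1; q1 ^ 2]%N) gcd_numer R p q r s d / denom R q d.
Proof.
move=> hp q; rewrite !big_cons big_nil addr0.
rewrite -common_denominator3 ?denom_neq0 // /Ktilde_prime_cube -/q.
have q10 := prime_gt0 hp.
have q11 : (0 < q1.-1)%N by rewrite -ltnS prednK // prime_gt1.
have d0 : denom R q 1 = polyF (Psi R q1 \Po 'X^(q1 ^ 2)).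
  rewrite denom_dvdn // divn1 divnn totient_gt0 expn_gt0 q10 expr1.
  by rewrite Psi_prime_power.
have d1 : denom R q q1 = polyF ((Psi R q1 \Po 'X^q1) ^+ q1).
  have -> : denom R q q1 = polyF (Psi R (q1 ^ 2) ^+ (totient q %/ totient (q1 ^ 2))).
    by rewrite denom_dvdn ?dvdn_exp // [in (q %/ q1)%N]/q expnS mulKn.
  rewrite !totient_pfactor //= (expnS q1 1) expn1 mulnA mulKn ?muln_gt0 ?q11 //.
  by rewrite -(Psi_prime_power R 1 hp) expn1.
have d2 : denom R q (q1 ^ 2)%N = polyF (Psi R q1 ^+ (q1 ^ 2)).
  have e2 : (q %/ q1 ^ 2 = q1)%N by rewrite /q expnS mulnK // expn_gt0 q10.
  by rewrite denom_dvdn ?dvdn_exp2l // e2 totient_pfactor // totient_prime // mulKn.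
rewrite d0 d1 d2 (@P_sum_prime_power q1 3 0) //; last first.
  rewrite subn0 -[LHS]map_id; rewrite (eq_map (g := id)) => [|t] //.
  by rewrite expn0 muln1.
rewrite (@P_sum_prime_power q1 3 1) // (@P_sum_prime_power q1 3 2) //; last first.
  by rewrite expn1 filter_coprime_ltn_prime.
by rewrite expn1 /polyF !rmorphM.
Qed.

End Numerators.

Lemma mulf_eq_iff (F : fieldType) (a x y : F) : a != 0 -> a * x = a * y <-> x = y.
Proof. by move=> a0; split=> [/(mulfI a0) | ->]. Qed.

Theorem theorem4 (R : realType) (n k p q : nat)
    (hn : (2 <= n)%N) (hq : totient q = (2 * n + 2 * k)%N)
    (r r' : 'I_n -> int) (s s' : 'I_k -> int)
    (hrs : defining_sets q r s) (hrs' : defining_sets q r' s') :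
  [/\ forall q1 q2 : nat,
        prime q1 -> odd q1 -> prime q2 -> odd q2 -> q1 <> q2 ->
        q = (q1 * q2)%N ->
        (genfun R p q r = genfun R p q r' <->
         Ktilde_two_primes R p q1 q2 r s = Ktilde_two_primes R p q1 q2 r' s'),
      prime q ->
        (genfun R p q r = genfun R p q r' <->
         Ktilde_prime R p q r s = Ktilde_prime R p q r' s'),
      forall q1 : nat, prime q1 -> q = (q1 ^ 2)%N ->
        (genfun R p q r = genfun R p q r' <->
         Ktilde_prime_square R p q1 r s = Ktilde_prime_square R p q1 r' s')
    & forall q1 : nat, prime q1 -> q = (q1 ^ 3)%N ->
        (genfun R p q r = genfun R p q r' <->
         Ktilde_prime_cube R p q1 r s = Ktilde_prime_cube R p q1 r' s')].
Proof.
have q0 : (0 < q)%N by rewrite -totient_gt0 hq; lia.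
split=> [q1 q2 p1 _ p2 _ ne eq|pq|q1 p1 eq|q1 p1 eq].
- subst q; apply: iff_trans (genfun_eq_gcd R p q0 hq hrs hrs' (ds := [:: 1%N; q1; q2]) _ _) _.
  + have [g1 g2] : (1 < q1)%N /\ (1 < q2)%N by split; apply: prime_gt1.
    have /eqP n12 := ne.
    by rewrite /= !inE !(eq_sym 1%N) (gtn_eqF g1) (gtn_eqF g2) n12.
  + move=> t tq; rewrite !inE.
    have [//|g] := eqVneq (gcdn t (q1 * q2)) 1%N.
    (* An index not prime to [q] shares a factor with [q1] or else with [q2]; the second case is the
       first with the primes exchanged. *)
    have [g1|g1] := eqVneq (gcdn t q1) 1%N; last by rewrite (gcdn_two_primes p1 p2) ?eqxx ?orbT.
    have g2 : gcdn t q2 != 1%N.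
      by apply: contra g; rewrite -!/(coprime _ _) coprimeMr /coprime g1 => ->.
    by rewrite mulnC (gcdn_two_primes p2 p1) ?eqxx ?orbT // mulnC.
  rewrite (Ktilde_two_primesE R p r s p1 p2 ne) (Ktilde_two_primesE R p r' s' p1 p2 ne).
  apply: iff_sym; apply: mulf_eq_iff.
  by rewrite !mulf_neq0 ?denom_neq0.
- apply: iff_trans (genfun_eq_gcd R p q0 hq hrs hrs' (ds := [:: 1%N]) _ _) _.
  + by [].
  + by move=> t; have := @gcdn_prime_power_mem q 1 t pq; rewrite expn1.
  rewrite (Ktilde_primeE R p r s pq) (Ktilde_primeE R p r' s' pq).
  (* After this both sides are the same affine function of their sums over the gcd classes. *)
  rewrite (numer_order R p r r' s s' q0).
  apply: iff_sym; apply: affine_eq.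
  exact: denom_neq0.
- subst q; apply: iff_trans (genfun_eq_gcd R p q0 hq hrs hrs' (ds := [:: 1%N; q1]) _ _) _.
  + by rewrite /= !inE eq_sym gtn_eqF ?prime_gt1.
  + by move=> t /(gcdn_prime_power_mem p1); rewrite /= expn1.
  rewrite (Ktilde_prime_squareE R p r s p1) (Ktilde_prime_squareE R p r' s' p1).
  apply: iff_sym; apply: mulf_eq_iff.
  by rewrite !mulf_neq0 ?denom_neq0.
subst q; apply: iff_trans
  (genfun_eq_gcd R p q0 hq hrs hrs' (ds := [:: 1; q1; q1 ^ 2]%N) _ _) _.
(* The three gcd values are read as powers of [q1], and exponentiation to a base above 1 is
   injective. *)
- rewrite -[[:: _; _; _]]/(map (expn q1) [:: 0; 1; 2]%N) map_inj_uniq //.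
  exact/expnI/prime_gt1.
- by move=> t /(gcdn_prime_power_mem p1); rewrite /= expn1.
rewrite (Ktilde_prime_cubeE R p r s p1) (Ktilde_prime_cubeE R p r' s' p1).
apply: iff_sym; apply: mulf_eq_iff.
by rewrite !mulf_neq0 ?denom_neq0.
Qed.
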